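(* Let $C$ be a cycle of goods and $N$ a set of agents of at most three types. Then there exists a $\frac34$-sufficient allocation of the goods of $C$ to the agents in $N$.
   Context: A cycle of goods has goods $v_1,\dots,v_m$ with edges $v_iv_{i+1}$ and $v_mv_1$. A utility function assigns a non-negative real to each good, extended additively to sets. A bundle is a set of goods inducing a connected subgraph (empty allowed); an $n$-split is a sequence of $n$ pairwise disjoint bundles (possibly empty) with union all goods. $\mathrm{mms}^{(n)}(C,u)=\max_{P_1,\dots,P_n}\min_i u(P_i)$ over all $n$-splits. Agents are of the same type if they have the same utility function. An allocation to agents $1,\dots,n$ with utilities $u_1,\dots,u_n$ is an $n$-split $P_1,\dots,P_n$ with $P_i$ given to agent $i$; for $c>0$ it is $c$-sufficient if $u_i(P_i)\ge c\cdot\mathrm{mms}^{(n)}(C,u_i)$ for all $i$. *)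

(* Defs.v *)
From HB Require Import structures.
From mathcomp Require Import all_boot all_order all_algebra.
Set Implicit Arguments. Unset Strict Implicit. Unset Printing Implicit Defensive.
Import Order.TTheory GRing.Theory Num.Theory.
Local Open Scope ring_scope.

Definition cyc_adj (m : nat) : rel 'I_m :=
  fun x y => ((x.+1 %% m)%N == y) || ((y.+1 %% m)%N == x).

(* A set of goods S is a bundle iff it induces a connected subgraph of the
   cycle (the empty set is allowed). *)
Definition is_bundle (m : nat) (S : {set 'I_m}) : bool :=
  [forall x in S, forall y in S,
     connect (fun a b => [&& a \in S, b \in S & cyc_adj a b]) x y].

(* An n-split: each good is assigned to exactly one of the n bundles
   (pairwise disjoint, union = all goods); bundle i is [set g | P g == i]. *)
Definition bundle_of (m n : nat) (P : {ffun 'I_m -> 'I_n}) (i : 'I_n) : {set 'I_m} :=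
  [set g | P g == i].

Definition is_split (m n : nat) (P : {ffun 'I_m -> 'I_n}) : bool :=
  [forall i, is_bundle (bundle_of P i)].

Definition uval (R : realFieldType) (m : nat) (u : 'I_m -> R) (S : {set 'I_m}) : R :=
  \sum_(g in S) u g.

(* min_i u(P_i); the identity element u(all goods) is an upper bound of all
   bundle values for nonnegative u, so this is the true minimum when n >= 1. *)
Definition split_min (R : realFieldType) (m n : nat) (u : 'I_m -> R)
    (P : {ffun 'I_m -> 'I_n}) : R :=
  \big[Num.min/uval u [set: 'I_m]]_(i < n) uval u (bundle_of P i).

(* mms^{(n)}(C,u) = max over n-splits of min_i u(P_i); the identity 0 is a lower
   bound of all these minima for nonnegative u. *)
Definition mms (R : realFieldType) (m n : nat) (u : 'I_m -> R) : R :=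
  \big[Num.max/0]_(P : {ffun 'I_m -> 'I_n} | is_split P) split_min u P.

Definition c_sufficient (R : realFieldType) (m n : nat) (c : R)
    (U : 'I_n -> 'I_m -> R) (P : {ffun 'I_m -> 'I_n}) : Prop :=
  is_split P /\ forall i : 'I_n, c * mms n (U i) <= uval (U i) (bundle_of P i).

(* Main.v *)
Require Import Defs.
From HB Require Import structures.
From mathcomp Require Import all_boot all_order all_algebra zify lra.
From Stdlib Require Import Classical_Prop.
Import Order.TTheory GRing.Theory Num.Theory.
Local Open Scope ring_scope.
Set Implicit Arguments. Unset Strict Implicit. Unset Printing Implicit Defensive.

(* Scale every utility so that the maximin share is 1 and unroll the cycle to
   nat, where a splitting of one type becomes a periodic sequence of cuts.
   Two types are tied if a piece of some 3/4-splitting of one lies inside a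
   piece of some 3/4-splitting of the other.  Otherwise their cuts strictly
   interleave, and each cut of one leaves more than 1/4 on both sides of the
   piece of the other type that it hits; hence two consecutive pieces of one
   type cannot both be worth less than 3/4 to the other.
   If x and y are tied, handing out the inner piece leaves a path on which both
   x and y still have one piece per remaining agent, and the third type f
   misses at most one.  A moving knife then serves everybody, provided that f
   gets its pieces early enough: priority is given to f whenever the next piece
   is worth 3/4 to it.  This works if f is the smallest type, and also if f is
   not tied to a type among x, y that is at least as numerous as f.
   If no two types are tied, their cuts appear in the cyclic order a b c.
   Either some interval from a cut a to the next cut c is worth 3/4 to the
   middle type and can play the role of the inner piece, or every piece of the
   first type is worth 3/4 to the middle type, and each agent of the last type
   can share two consecutive such pieces with another agent. *)

Ltac natlia := repeat match goal with H : ?T |- _ =>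
  lazymatch T with is_true (leq _ _) => fail | @eq nat _ _ => fail | _ => clear H end end; lia.

Lemma min_in_seq (I : eqType) (l : seq I) (h : I -> nat) :
  l != [::] -> exists2 i, i \in l & forall j, j \in l -> (h i <= h j)%N.
Proof.
elim: l => [//|i l IH] _; have [-> | /IH[k kl kmin]] := eqVneq l [::].
  by exists i => [|j]; rewrite ?mem_head // inE => /eqP->.
have [hik|hki] := leqP (h i) (h k).
  exists i => [|j]; rewrite ?mem_head // inE => /predU1P[->//|/kmin].
  exact: leq_trans.
exists k => [|j]; rewrite inE ?kl ?orbT // => /predU1P[->|/kmin//].
exact: ltnW.
Qed.

Lemma count_take_out (I : eqType) (P : pred I) (l : seq I) (i : I) :
  i \in l -> count P l = (P i + count P (rem i l))%N.
Proof. by move=> il; rewrite (permP (perm_to_rem il)). Qed.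

(** * Serving agents from left to right along a path *)

Section Path.
Variables (R : realFieldType) (I : eqType) (G : I -> nat -> R).
Hypothesis Gmono : forall i x y, (x <= y)%N -> G i x <= G i y.

(** [G i x] stands for the value to [i] of the goods before position [x], scaled so that the maximin
    share is 1; hence the constant. *)
Definition ok i x y := 3 / 4 <= G i y - G i x.

Lemma ok_lt i x y : ok i x y -> (x < y)%N.
Proof.
rewrite /ok => h; rewrite ltnNge; apply/negP => /(@Gmono i); lra.
Qed.

Lemma ok_widen i x y x' y' : (x' <= x)%N -> (y <= y')%N -> ok i x y -> ok i x' y'.
Proof. by rewrite /ok => /(@Gmono i) hx /(@Gmono i) hy; lra. Qed.

(** The order of the agents is chosen on the way. [serve_nil] tolerates a remainder before [t],
    which [serve_owner] adds to the last piece. *)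
Inductive serve (t : nat) : nat -> seq I -> Prop :=
| serve_nil s : (s <= t)%N -> serve t s [::]
| serve_cons s z i l : i \in l -> ok i s z -> serve t z (rem i l) -> serve t s l.

Fixpoint pieces i t z k : Prop :=
  if k is k'.+1 then exists2 z', ok i z z' & pieces i t z' k' else (z <= t)%N.

Lemma pieces_widen i t z z' k : (z' <= z)%N -> pieces i t z k -> pieces i t z' k.
Proof.
case: k => [|k] /= h; first exact: leq_trans.
by case=> y o p; exists y => //; apply: ok_widen o.
Qed.

Lemma pieces_chain i t (q : nat -> nat) k z :
    (z <= q 0)%N -> (q k <= t)%N -> (forall j, (j < k)%N -> ok i (q j) (q j.+1)) ->
  pieces i t z k.
Proof.
elim: k z q => [|k IH] z q zq qt H /=; first exact: leq_trans qt.
exists (q 1); first by apply: ok_widen (H 0%N _).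
by apply: (IH _ (q \o S)) => // j jk; apply: H.
Qed.

(* The agent whose first piece ends earliest takes it; this destroys at most
   one piece of every other agent. *)
Lemma serve_pieces t z l :
  (z <= t)%N -> (forall i, i \in l -> pieces i t z (size l)) -> serve t z l.
Proof.
have [k] := ubnP (size l); elim: k l z => // k IH l z lk zt H.
case E : (size l) => [|n].
  by move/size0nil: E => ->; apply: serve_nil.
have [i [il [y [oy Hy]]]] : exists i, i \in l /\ exists y, ok i z y /\
    forall j, j \in l -> pieces j t y n.
  have: l != [::] by rewrite -size_eq0 E.
  have: forall i, i \in l -> exists2 y, ok i z y & pieces i t y n.
    by move=> i /H; rewrite E.
  elim: (l) => [//|a s IHs] K _.
  have [y oy py] := K a (mem_head _ _).
  have [->|/IHs[b|b [bs [w [ow Hw]]]]] := eqVneq s [::].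
  - by exists a; rewrite mem_head; split=> //; exists y; split=> // j; rewrite inE => /eqP->.
  - by move=> bs; apply: K; rewrite inE bs orbT.
  have [yw|/ltnW wy] := leqP y w.
    exists a; rewrite mem_head; split=> //; exists y; split=> // j.
    by rewrite inE => /predU1P[->//|/Hw]; apply: pieces_widen.
  exists b; rewrite inE bs orbT; split=> //; exists w; split=> // j.
  by rewrite inE => /predU1P[->|/Hw//]; apply: pieces_widen py.
have sr : size (rem i l) = n by rewrite size_rem // E.
apply: (serve_cons il oy); apply: IH.
- by rewrite sr; move: lk; rewrite E.
- have := Hy i il; elim: (n) (y) => [|m IHm] w //= [w' o /IHm].
  by apply: leq_trans; apply/ltnW/(ok_lt o).
- by move=> j /mem_rem /Hy; rewrite sr.
Qed.

End Path.

(** * A moving knife with one flexible type *)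

Section Knife.
Variables (R : realFieldType) (I : eqType) (G : I -> nat -> R).
Hypothesis Gmono : forall i x y, (x <= y)%N -> G i x <= G i y.
(** On the path up to [t], each rigid agent has [K] pieces, given by its cuts [p i]. The flexible
    agents share the value [g]; their full pieces start only at [b 1], and after [b K] more than 1/4
    is left to them. *)
Variables (K t : nat) (f : pred I) (g : nat -> R) (b : nat -> nat) (p : I -> nat -> nat).
Hypothesis gmono : forall x y, (x <= y)%N -> g x <= g y.
Hypothesis Gg : forall i x, f i -> G i x = g x.
Hypothesis b_piece : forall j, (0 < j < K)%N -> 1 <= g (b j.+1) - g (b j).
Hypothesis b_last : 1 / 4 < g t - g (b K).
Hypothesis p_ok : forall i j, ~~ f i -> (j < K)%N -> ok G i (p i j) (p i j.+1).
Hypothesis p_last : forall i, ~~ f i -> (p i K <= t)%N.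

Let g_lt x y : g x < g y -> (x < y)%N.
Proof. by move=> h; rewrite ltnNge; apply/negP => /gmono; lra. Qed.

Let b_le_t j : (0 < j <= K)%N -> (b j <= t)%N.
Proof.
case/andP=> j0 jK; rewrite -(subKn jK).
have : (K - j < K)%N by lia.
elim: (K - j)%N => [|d IHd] dK.
  by rewrite subn0; apply/ltnW/g_lt; move: b_last; lra.
apply: leq_trans (IHd _); last lia.
have -> : (K - d = (K - d.+1).+1)%N by lia.
have h : 1 <= g (b (K - d.+1).+1) - g (b (K - d.+1)) by apply: b_piece; lia.
by apply/ltnW/g_lt; lra.
Qed.

Let p_le_t i j : ~~ f i -> (j <= K)%N -> (p i j <= t)%N.
Proof.
move=> fi jK; rewrite -(subKn jK); elim: (K - j)%N (leq_subr j K) => [|d IHd] dK.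
  by rewrite subn0 p_last.
apply: leq_trans (IHd _); last lia.
have -> : (K - d = (K - d.+1).+1)%N by lia.
by apply/ltnW/(ok_lt Gmono (p_ok fi _)); lia.
Qed.

Lemma p_pieces i j n z : ~~ f i -> (z <= p i j)%N -> (j + n = K)%N -> pieces G i t z n.
Proof.
move=> fi zp jn; apply: (pieces_chain Gmono (q := fun r => p i (j + r))).
- by rewrite addn0.
- by rewrite jn p_last.
- by move=> r rn; rewrite addnS; apply: p_ok => //; lia.
Qed.

Lemma serve_no_flexible j z l : count f l = 0%N -> (j + size l = K)%N -> (z <= t)%N ->
  (forall i, i \in l -> ~~ f i -> (z <= p i j)%N) -> serve G t z l.
Proof.
move=> cf jl zt zp; apply: (serve_pieces Gmono) => // i il.
have fi : ~~ f i by apply/negP => fi; move: (count_take_out f il); rewrite fi cf.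
exact: p_pieces (zp i il fi) jl.
Qed.

(* The position [z] leaves the flexible agents a full supply of pieces. *)
Lemma serve_caught_up j z l : (j.+1 + size l = K)%N -> (z <= t)%N ->
  (forall i, i \in l -> ~~ f i -> (z <= p i j.+1)%N) ->
  g z - g (b j.+1) <= 1 / 4 -> serve G t z l.
Proof.
move=> jl zt zp gz; apply: (serve_pieces Gmono) => // i il.
have [fi|fi] := boolP (f i); last exact: p_pieces (zp i il fi) jl.
case E : (size l) => [|n] //=.
have bj : 1 <= g (b j.+2) - g (b j.+1) by apply: b_piece; lia.
exists (b j.+2); first by rewrite /ok !Gg //; lra.
apply: (pieces_chain Gmono (q := fun r => b (j.+2 + r))).
- by rewrite addn0.
- by apply: b_le_t; lia.
- move=> r rn; rewrite addnS /ok !Gg //.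
  have h : 1 <= g (b (j.+2 + r).+1) - g (b (j.+2 + r)) by apply: b_piece; lia.
  by lra.
Qed.

Lemma serve_one_flexible i z : f i -> 3 / 4 <= g t - g z -> serve G t z [:: i].
Proof.
move=> fi gz; apply: (@serve_cons _ _ G t z t i); rewrite ?mem_head //.
  by rewrite /ok !Gg.
by rewrite /= eqxx; apply: serve_nil.
Qed.

Lemma rigid_next l j : (0 < count (predC f) l)%N ->
  exists2 i, (i \in l) && ~~ f i &
    forall k, k \in l -> ~~ f k -> (p i j <= p k j)%N.
Proof.
move=> h; have [|i] := @min_in_seq _ (filter (predC f) l) (p ^~ j).
  by rewrite -size_eq0 size_filter; lia.
rewrite mem_filter andbC => il H; exists i => // k kl fk.
by apply: H; rewrite mem_filter kl /= fk.
Qed.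

(* The flexible agents [f] own the pieces [b j.+1, b j.+2], ..., [b K.-1, b K]
   ahead of the knife [z], one less than the number of remaining agents.  The
   value left to them before [b j.+1] limits the number of consecutive pieces
   that they find too small: at most [2 - s]. *)
Lemma serve_flexible_third (s : nat) l j z : (s <= 2)%N -> (j + size l = K)%N -> (z <= t)%N ->
    (forall i, i \in l -> ~~ f i -> (z <= p i j)%N) ->
    s%:R / 4 <= g (b j.+1) - g z ->
    (2 * count f l <= count (predC f) l + s)%N ->
  serve G t z l.
Proof.
have [k] := ubnP (size l); elim: k l s j z => // k IH l s j z lk s2 jl zt zp gz cnt.
have := count_predC f l.
have [cf _|cf] := posnP (count f l); first exact: serve_no_flexible jl zt zp.
have s_ge0 : 0 <= s%:R :> R by [].
have sE : s%:R = 0 :> R \/ s%:R = 1 :> R \/ s%:R = 2 :> R.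
  by case: (s) s2 => [|[|[|]]] //; auto.
have [ch|ch] := posnP (count (predC f) l).
  rewrite ch addn0 => sl.
  case: l sl cf ch jl {lk zp IH cnt gz} (gz) (cnt) => [|i [|? ?]] //=; try natlia.
  case fi : (f i) => //= _ _ _ jK gz cnt; apply: serve_one_flexible => //.
  (* The last agent gets 2/4 before [b K] and more than 1/4 after it. *)
  have s2E : s = 2 by natlia.
  by move: b_last gz; rewrite s2E -jK addn1; lra.
move=> sl; have jK : (j.+1 < K)%N by natlia.
have bj : 1 <= g (b j.+2) - g (b j.+1) by apply: b_piece; natlia.
have [i /andP[il fi] imin] := rigid_next j.+1 ch.
set w := p i j.+1 in imin.
have wt : (w <= t)%N by apply: p_le_t => //; natlia.
have zw : ok G i z w by apply: (ok_widen Gmono (zp i il fi) (leqnn _)); apply: p_ok => //; natlia.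
have sr x : x \in l -> size (rem x l) = (size l).-1 by move=> xl; rewrite size_rem.
have wp (x y : I) : y \in rem x l -> ~~ f y -> (w <= p y j.+1)%N by move=> /mem_rem; apply: imin.
(* If [w] eats at most 1/4 of the next piece of [f], the rest of that piece is still worth 3/4. *)
have [l14|l14] := lerP (g w - g (b j.+1)) (1 / 4).
  apply: (serve_cons il zw); apply: (serve_caught_up (j := j)) => //; last exact: wp.
  by rewrite sr //; natlia.
have [good|bad] := lerP (3 / 4) (g w - g z).
  have [x /andP[xl fx]] : exists x, (x \in l) && f x.
    by move: cf; rewrite -has_count => /hasP[x xl fx]; exists x; rewrite xl.
  have cfx := count_take_out f xl; have chx := count_take_out (predC f) xl.
  rewrite /= fx /= in cfx chx.
  (* The knife stops at [b j.+2] if [w] lies beyond it, so that the following piece of [f] stays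
     intact. *)
  have [gw|gw] := leqP (b j.+2) w.
    have := gmono gw => gw'.
    apply: (serve_cons (z := b j.+2) xl); first by rewrite /ok !Gg //; lra.
    apply: (IH (rem x l) 0%N j.+1); rewrite ?sr //.
    - by natlia.
    - by natlia.
    - by apply: b_le_t; natlia.
    - by move=> y yl fy; apply: leq_trans (wp _ _ yl fy).
    - by rewrite mul0r subrr.
    - by natlia.
  apply: (serve_cons (z := w) xl); first by rewrite /ok !Gg //; lra.
  have := gmono (ltnW gw) => gw'.
  apply: (IH (rem x l) 0%N j.+1); rewrite ?sr //.
  - by natlia.
  - by natlia.
  - exact: wp.
  - by rewrite mul0r subr_ge0.
  - by natlia.
(* With [s = 2] the interval up to [w] would be worth 2/4 + 1/4 to [f]. *)
have s1 : (s < 2)%N.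
  by rewrite ltn_neqAle s2 andbT; apply/eqP => s2E; move: gz bad l14; rewrite s2E; lra.
have cfi := count_take_out f il; have chi := count_take_out (predC f) il.
rewrite /= (negbTE fi) /= in cfi chi.
apply: (serve_cons il zw); apply: (IH (rem i l) s.+1 j.+1); rewrite ?sr //.
- by natlia.
- by natlia.
- exact: wp.
(* The interval given away is below 3/4 and the next piece at least 1, so the value left before the
   next cut grows by 1/4. *)
- by rewrite -natr1; lra.
- by natlia.
Qed.

(* While agents of [J] remain, the knife always stops at least 1/4 before the
   next [b], so two consecutive pieces are never both too small for [f]. *)
Lemma serve_flexible_half (J : pred I) (s : nat) l j z :
    {subset J <= predC f} ->
    (forall i j, J i -> (j < K)%N -> 1 / 4 <= g (b j.+1) - g (p i j)) ->
    (s <= 1)%N -> (j + size l = K)%N -> (z <= t)%N ->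
    (forall i, i \in l -> ~~ f i -> (z <= p i j)%N) ->
    s.+1%:R / 4 <= g (b j.+1) - g z ->
    (count f l <= count J l + s)%N ->
  serve G t z l.
Proof.
move=> Jf Jb; have [k] := ubnP (size l); elim: k l s j z => // k IH l s j z lk s1 jl zt zp gz cnt.
have := count_predC f l.
have [cf _|cf] := posnP (count f l); first exact: serve_no_flexible jl zt zp.
have sE : s = 0%N \/ s = 1%N by natlia.
have cJ : (count J l <= count (predC f) l)%N by apply: sub_count => i; apply: Jf.
have [ch|ch] := posnP (count (predC f) l).
  rewrite ch addn0 => sl.
  case: l sl cf ch jl {lk zp IH} gz cnt cJ => [|i [|? ?]] //=; try natlia.
  case fi : (f i) => //= _ _ _ jK gz' cnt' cJ; apply: serve_one_flexible => //.
  have s1E : s = 1%N by natlia.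
  by move: b_last gz'; rewrite s1E -jK addn1; lra.
move=> sl; have jK : (j.+1 < K)%N by natlia.
have bj : 1 <= g (b j.+2) - g (b j.+1) by apply: b_piece; natlia.
have [i /andP[il fi] imin] := rigid_next j.+1 ch.
set w := p i j.+1 in imin.
have wt : (w <= t)%N by apply: p_le_t => //; natlia.
have zw : ok G i z w by apply: (ok_widen Gmono (zp i il fi) (leqnn _)); apply: p_ok => //; natlia.
have sr x : x \in l -> size (rem x l) = (size l).-1 by move=> xl; rewrite size_rem.
have wp (x y : I) : y \in rem x l -> ~~ f y -> (w <= p y j.+1)%N by move=> /mem_rem; apply: imin.
have [l14|l14] := lerP (g w - g (b j.+1)) (1 / 4).
  apply: (serve_cons il zw); apply: (serve_caught_up (j := j)) => //; last exact: wp.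
  by rewrite sr //; natlia.
have [x /andP[xl fx]] : exists x, (x \in l) && f x.
  by move: cf; rewrite -has_count => /hasP[x xl fx]; exists x; rewrite xl.
have cfx := count_take_out f xl; have cJx := count_take_out J xl.
have Jx : J x = false by apply/negP => /Jf; rewrite inE /= fx.
rewrite fx Jx /= in cfx cJx.
(* Without [J] the counting leaves a single flexible agent and [s = 1]; it gets 2/4 before [b j.+1]
   and 1/4 after it. *)
have [J0|J0] := posnP (count J l).
  have s1E : s = 1%N by natlia.
  apply: (serve_cons (z := w) xl).
    by rewrite /ok !Gg //; move: gz; rewrite s1E; lra.
  apply: (serve_no_flexible (j := j.+1)); rewrite ?sr //.
  - by natlia.
  - by natlia.
  - exact: wp.
have gw : 1 / 4 <= g (b j.+2) - g w.
  move: J0; rewrite -has_count => /hasP[y yl Jy].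
  have := gmono (imin y yl (Jf _ Jy)); have := Jb _ _ Jy jK; lra.
have [good|bad] := lerP (3 / 4) (g w - g z).
  apply: (serve_cons (z := w) xl); first by rewrite /ok !Gg //; lra.
  apply: (IH (rem x l) 0%N j.+1); rewrite ?sr //.
  - by natlia.
  - by natlia.
  - exact: wp.
  - by natlia.
have s0 : s = 0%N.
  by case: sE => // s1E; exfalso; move: gz bad l14; rewrite s1E; lra.
have cfi := count_take_out f il; have cJi := count_take_out J il.
rewrite /= (negbTE fi) /= in cfi.
apply: (serve_cons il zw); apply: (IH (rem i l) 1%N j.+1); rewrite ?sr //.
- by natlia.
- by natlia.
- exact: wp.
(* The value left before [b j.+2] is at least 1/4 + 1 - 3/4 = 2/4. *)
- by move: gz; rewrite s0; lra.
- by natlia.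
Qed.

End Knife.

(** * Sharing two consecutive pieces *)

Section Halves.
Variables (R : realFieldType) (I : eqType) (G : I -> nat -> R).
Hypothesis Gmono : forall i x y, (x <= y)%N -> G i x <= G i y.
Variables (d : nat -> nat) (easy : pred I) .
Hypothesis easy_ok : forall i j, easy i -> ok G i (d j) (d j.+1).

(* A picky agent and an easy one share two consecutive pieces. *)
Lemma serve_halves l j :
    (forall i j, i \in l -> ~~ easy i -> ok G i (d j) (d j.+1) \/ ok G i (d j.+1) (d j.+2)) ->
    (count (predC easy) l <= count easy l)%N ->
  serve G (d (j + size l)) (d j) l.
Proof.
have [k] := ubnP (size l); elim: k l j => // k IH l j lk lok cnt.
case E : (size l) => [|n].
  by move/size0nil: E => ->; rewrite addn0; apply: serve_nil.
have [i il ei] : exists2 i, i \in l & easy i.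
  by apply/hasP; rewrite has_count; have := count_predC easy l; natlia.
have sri x : x \in l -> size (rem x l) = n by move=> xl; rewrite size_rem // E.
have cei := count_take_out easy il; have chi := count_take_out (predC easy) il.
rewrite /= ei /= in cei chi.
have [h0|] := posnP (count (predC easy) l).
  apply: (serve_cons il (easy_ok j ei)).
  have -> : (j + n.+1 = j.+1 + size (rem i l))%N by rewrite sri //; natlia.
  apply: IH; rewrite ?sri //; try natlia.
  by move=> y q /mem_rem; apply: lok.
rewrite -has_count => /hasP[y yl /= ey].
have both x1 x2 : x1 \in l -> x2 \in l -> easy x1 (+) easy x2 ->
    ok G x1 (d j) (d j.+1) -> ok G x2 (d j.+1) (d j.+2) -> serve G (d (j + n.+1)) (d j) l.
  move=> x1l x2l x12 o1 o2; apply: (serve_cons x1l o1).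
  have x2r : x2 \in rem x1 l.
    have : x2 \in x1 :: rem x1 l by rewrite -(perm_mem (perm_to_rem x1l)).
    by rewrite inE => /predU1P[x2E|//]; move: x12; rewrite x2E addbb.
  apply: (serve_cons x2r o2).
  have c1 := count_take_out easy x1l; have c2 := count_take_out easy x2r.
  have c1' := count_take_out (predC easy) x1l; have c2' := count_take_out (predC easy) x2r.
  have sr2 : (size (rem x2 (rem x1 l))).+2 = size l.
    by rewrite size_rem // sri // E; case: (n) (sri _ x1l) x2r => // /size0nil ->.
  have -> : (j + n.+1 = j.+2 + size (rem x2 (rem x1 l)))%N by natlia.
  rewrite /= in c1' c2'.
  apply: IH; first natlia; last by case: (easy x1) (easy x2) x12 c1 c2 c1' c2' => -[] //= _; natlia.
  by move=> v q /mem_rem /mem_rem; apply: lok.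
have yi : easy y (+) easy i by rewrite ei (negbTE ey).
have [o|o] := lok y j yl ey; first by apply: (both y i) => //; apply: easy_ok.
by apply: (both i y) => //; [rewrite addbC | apply: easy_ok].
Qed.
End Halves.

(** * Periodic cuts on the unrolled cycle, and ties *)

Section Cycle.
Variables (R : realFieldType) (T : eqType) (m n : nat) (F : T -> nat -> R) (kind : 'I_n -> T).
Hypothesis n_gt1 : (1 < n)%N.
Hypothesis Fmono : forall k x y, (x <= y)%N -> F k x <= F k y.
Hypothesis Fper : forall k x y, F k (y + m) - F k (x + m) = F k y - F k x.

Let G i := F (kind i).
Let Gmono i x y : (x <= y)%N -> G i x <= G i y. Proof. exact: Fmono. Qed.

Definition feasible := exists s, serve G (s + m) s (enum 'I_n).

Definition cuts c k (a : nat -> nat) :=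
  (forall j, a (j + n) = a j + m)%N /\ (forall j, c <= F k (a j.+1) - F k (a j)).

Lemma F_lt k x y : F k x < F k y -> (x < y)%N.
Proof. by move=> h; rewrite ltnNge; apply/negP => /(@Fmono k); lra. Qed.

Lemma Fper_mul k x y q : F k (y + m * q) - F k (x + m * q) = F k y - F k x.
Proof. by elim: q => [|q IH]; rewrite ?muln0 ?addn0 // mulnS (addnC m) !addnA Fper. Qed.

Lemma cuts_shift c k a i : cuts c k a -> cuts c k (fun j => a (i + j))%N.
Proof. by case=> p h; split=> j; rewrite ?addnA ?addnS. Qed.

Lemma cuts_weaken c c' k a : c' <= c -> cuts c k a -> cuts c' k a.
Proof. by move=> cc [p h]; split=> // j; apply: le_trans cc (h j). Qed.

Lemma cuts34 k a : cuts 1 k a -> cuts (3 / 4) k a.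
Proof. by apply: cuts_weaken; lra. Qed.

Lemma cuts_period c k a j q : cuts c k a -> a (j + n * q)%N = (a j + m * q)%N.
Proof.
case=> p _; elim: q => [|q IH]; rewrite ?muln0 ?addn0 // !mulnS.
by rewrite (addnC n) addnA p IH (addnC m) addnA.
Qed.

Lemma cuts_lt k a j : cuts (3 / 4) k a -> (a j < a j.+1)%N.
Proof. by case=> _ h; apply: (@F_lt k); have := h j; lra. Qed.

Lemma cuts_leq k a i j : cuts (3 / 4) k a -> (i <= j)%N -> (a i <= a j)%N.
Proof.
move=> h /subnKC <-; elim: (j - i)%N => [|d IH]; rewrite ?addn0 // addnS.
exact: leq_trans IH (ltnW (cuts_lt _ h)).
Qed.

Lemma cuts_far k a N : cuts (3 / 4) k a -> (N <= a N)%N.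
Proof. by move=> h; elim: N => // N; move/leq_ltn_trans; apply; apply: cuts_lt h. Qed.

(** Index shifts by [n * N] are whole turns, so a splitting can be moved to the right of any given
    position, as [cuts_locate] requires. *)
Lemma cuts_after k a N : cuts (3 / 4) k a -> (N <= a (n * N))%N.
Proof.
move=> h; apply: leq_trans (cuts_far N h) (cuts_leq h _).
by apply: leq_pmull; natlia.
Qed.

Lemma cuts_locate k b x : cuts (3 / 4) k b -> (b 0 <= x)%N ->
  exists i, (b i <= x < b i.+1)%N.
Proof.
move=> h bx; have ex : exists i, (x < b i)%N by exists x.+1; apply: cuts_far h.
case: (ex_minnP ex) => -[|i] xi imin; first by natlia.
by exists i; rewrite xi andbT leqNgt; apply/negP => /imin; rewrite ltnn.
Qed.

(** The piece across the end of a turn stops at [p 0 + m] instead of [p n], which can only enlarge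
    it. *)
Lemma cuts_periodize c k (p : nat -> nat) :
    (forall j, (j < n)%N -> c <= F k (p j.+1) - F k (p j)) -> (p n <= p 0 + m)%N ->
  exists2 a, cuts c k a & forall j, (j < n)%N -> a j = p j.
Proof.
move=> h pn; have n0 : (0 < n)%N by natlia.
exists (fun j => p (j %% n) + m * (j %/ n))%N; last first.
  by move=> j jn; rewrite modn_small // divn_small // muln0 addn0.
split=> j.
  by rewrite modnDr divnDr // divnn n0 addn1 mulnS (addnC m) addnA.
have := h _ (ltn_pmod j n0).
have [jn|jn] := ltnP (j %% n).+1 n.
  have -> : (j.+1 %% n = (j %% n).+1)%N by rewrite -addn1 -modnDml addn1 modn_small.
  have -> : (j.+1 %/ n = j %/ n)%N.
    by rewrite {1}(divn_eq j n) -addnS divnMDl // (divn_small jn) addn0.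
  by rewrite Fper_mul.
have jE : (j %% n).+1 = n by apply/eqP; rewrite eqn_leq jn ltn_pmod.
have -> : (j.+1 %% n = 0)%N by rewrite -addn1 -modnDml addn1 jE modnn.
have -> : (j.+1 %/ n = (j %/ n).+1)%N.
  by rewrite {1}(divn_eq j n) -addnS jE -mulSnr mulnK.
move/le_trans; apply; rewrite mulnS addnA -(Fper_mul _ _ _ (j %/ n)).
by rewrite lerD2r jE; apply: Fmono; rewrite leq_add2r.
Qed.

Definition tied x y := exists a c,
  [/\ cuts (3 / 4) x a, cuts (3 / 4) y c, (c 0 <= a 0)%N & (a 1 <= c 1)%N].

(** Otherwise the piece of [x] from [a i] would lie in the piece of [y] from [c k], and the shifted
    cuts would witness a tie. *)
Lemma free_step x y a c i k : ~ tied x y -> cuts (3 / 4) x a -> cuts (3 / 4) y c ->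
  (c k <= a i)%N -> (c k.+1 < a i.+1)%N.
Proof.
move=> fr sa sc h; rewrite ltnNge; apply/negP => h'; apply: fr.
exists (fun j => a (i + j))%N, (fun j => c (k + j))%N.
by rewrite !addn0 !addn1; split=> //; apply: cuts_shift.
Qed.

Lemma free_iter x y a c i k r : ~ tied x y -> cuts (3 / 4) x a -> cuts (3 / 4) y c ->
  (c k <= a i)%N -> (c (k + r) <= a (i + r))%N.
Proof.
move=> fr sa sc h; elim: r => [|r IH]; rewrite ?addn0 // !addnS.
exact: ltnW (free_step fr sa sc IH).
Qed.

(** After a full turn, a common cut would lie strictly behind itself. *)
Lemma free_neq x y a c i k : ~ tied x y -> cuts (3 / 4) x a -> cuts (3 / 4) y c ->
  a i <> c k.
Proof.
move=> fr sa sc e; have := free_iter n.-1 fr sa sc (eq_leq (esym e)).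
move/(free_step fr sa sc); rewrite -!addnS prednK; last by natlia.
by rewrite (proj1 sa) (proj1 sc) e ltnn.
Qed.

(** Without a tie in the other direction, [a 1 <= c 1] propagates around the cycle to [a 0 <= c 0],
    so these two cuts coincide. *)
Lemma tied_sym x y : tied x y -> tied y x.
Proof.
case=> a [c [sa sc h0 h1]]; apply: NNPP => fr.
have := free_iter n.-1 fr sc sa h1; rewrite !add1n prednK; last by natlia.
rewrite -[n]add0n (proj1 sa) (proj1 sc) leq_add2r => h2.
by apply: (free_neq (i := 0%N) (k := 0%N) fr sc sa); apply/eqP; rewrite eqn_leq h0.
Qed.

(* Otherwise moving the cut [b r] to [c s] gives a 3/4-splitting for [f] that
   shares a cut with [c]. *)
Lemma free_deep_left y f c b r s : ~ tied y f -> cuts (3 / 4) y c -> cuts 1 f b ->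
  (b r <= c s <= b r.+1)%N -> 1 / 4 < F f (c s) - F f (b r).
Proof.
move=> fr sc sb /andP[h1 h2]; rewrite ltNge; apply/negP => h.
have nz : (n == 0%N) = false by clear -n_gt1; lia.
have [||a sa ac] := @cuts_periodize (3 / 4) f (fun j => if j == 0%N then c s else b (r + j)%N).
- case=> [|j] _ /=; first by have := (proj2 sb) r; rewrite addn1; lra.
  by have := (proj2 sb) (r + j.+1)%N; rewrite -addnS; lra.
- by rewrite nz (proj1 sb) leq_add2r.
apply: (free_neq (i := s) (k := 0%N) fr sc sa); rewrite ac //; natlia.
Qed.

(** The mirror image: the cut [b r.+1] is moved back to [c s]. *)
Lemma free_deep_right y f c b r s : ~ tied y f -> cuts (3 / 4) y c -> cuts 1 f b ->
  (b r <= c s <= b r.+1)%N -> 1 / 4 < F f (b r.+1) - F f (c s).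
Proof.
move=> fr sc sb /andP[h1 h2]; rewrite ltNge; apply/negP => h.
have nz : (n == 1%N) = false by clear -n_gt1; lia.
have [||a sa ac] := @cuts_periodize (3 / 4) f (fun j => if j == 1%N then c s else b (r + j)%N).
- case=> [|[|j]] _ /=.
  + by have := (proj2 sb) r; rewrite addn0; lra.
  + by have := (proj2 sb) r.+1; have := Fmono f h2; rewrite addn2; lra.
  by have := (proj2 sb) (r + j.+2)%N; rewrite -addnS; lra.
- by rewrite nz (proj1 sb) /= addn0.
by apply: (free_neq (i := s) (k := 1%N) fr sc sa); rewrite ac.
Qed.

(** Once [a 0] is located in a piece of [b], propagation in both directions keeps all later cuts
    interleaved. *)
Lemma free_align x f a b : ~ tied x f -> cuts (3 / 4) x a -> cuts 1 f b ->
    (b 0 <= a 0)%N ->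
  exists2 b', cuts 1 f b' & forall r, (b' r <= a r <= b' r.+1)%N.
Proof.
move=> fr sa sb h; have sb' := cuts34 sb.
have fr' : ~ tied f x by move/tied_sym.
have [i /andP[h1 h2]] := cuts_locate sb' h.
exists (fun j => b (i + j))%N; first exact: cuts_shift.
move=> r; rewrite (free_iter (i := 0%N) r fr sa sb' h1) addnS -addSn.
exact: (free_iter (k := 0%N) r fr' sb' sa (ltnW h2)).
Qed.

Hypothesis cut : forall k, exists b, cuts 1 k b.

(** Two consecutive pieces of [q] contain a whole piece of [f] and more than 1/4 on either side of
    it, hence more than 3/2 in total. *)
Lemma free_half q f a j : ~ tied q f -> cuts (3 / 4) q a ->
  3 / 4 <= F f (a j.+1) - F f (a j) \/ 3 / 4 <= F f (a j.+2) - F f (a j.+1).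
Proof.
move=> fr sa; have [b0 sb0] := cut f.
pose N := b0 0%N; have sa' := cuts_shift (n * N) sa.
have [|b sb hb] := free_align fr sa' sb0.
  by rewrite addn0; apply: cuts_after sa.
have per r : a (n * N + r)%N = (a r + m * N)%N by rewrite addnC (cuts_period _ _ sa).
have l := free_deep_right fr sa' sb (hb j).
have r := free_deep_left fr sa' sb (hb j.+2).
have mid := (proj2 sb) j.+1.
have : 3 / 2 < F f (a (n * N + j.+2)%N) - F f (a (n * N + j)%N) by lra.
rewrite !per Fper_mul => h.
by have [|h'] := lerP (3 / 4) (F f (a j.+1) - F f (a j)); [left | right; lra].
Qed.

(** * Sufficient conditions for serving everybody *)

Let agents := enum 'I_n.
Let size_agents : size agents = n. Proof. exact: size_enum_ord. Qed.
Let in_agents i : i \in agents. Proof. exact: mem_enum. Qed.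
Let number k := count (fun i => kind i == k) agents.

Lemma feasible_halves q (easy : pred T) d :
    cuts (3 / 4) q d ->
    (forall k j, easy k -> 3 / 4 <= F k (d j.+1) - F k (d j)) ->
    (forall i, ~~ easy (kind i) -> ~ tied q (kind i)) ->
    (count (fun i => ~~ easy (kind i)) agents <= count (fun i => easy (kind i)) agents)%N ->
  feasible.
Proof.
move=> sd ed fr cnt; exists (d 0%N).
have <- : d (0 + size agents)%N = (d 0 + m)%N by rewrite size_agents (proj1 sd).
apply: (serve_halves (easy := fun i => easy (kind i))) => //.
  by move=> i j ei; apply: ed.
by move=> i j _ ei; apply: (free_half _ (fr i ei) sd).
Qed.

Lemma cuts_pieces i k a j t z r : cuts (3 / 4) k a -> kind i = k ->
  (z <= a j)%N -> (a (j + r) <= t)%N -> pieces G i t z r.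
Proof.
move=> sa ki za at_; apply: (pieces_chain Gmono (q := fun s => a (j + s)%N)) => //.
- by rewrite addn0.
by move=> s _; rewrite addnS /ok /G ki; apply: (proj2 sa).
Qed.

Lemma feasible_take i s z : ok G i s z -> (z <= s + m)%N ->
  (forall i', pieces G i' (s + m) z n.-1) -> feasible.
Proof.
move=> o zs H; exists s; apply: (serve_cons (in_agents i) o).
by apply: (serve_pieces Gmono) => // i' _; rewrite size_rem // size_agents.
Qed.

Lemma number_pos k : (0 < number k)%N -> exists i, kind i = k.
Proof. by rewrite /number -has_count => /hasP[i _ /eqP]; exists i. Qed.

(* Hand the inner piece [a 0, a 1] to [i0].  Unless the third type still has
   n - 1 pieces left, exactly one of its cuts lies deep inside [a 0, a 1]. *)
Lemma tied_cases x y f i0 : tied x y -> kind i0 = x ->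
    (forall i, [\/ kind i = x, kind i = y | kind i = f]) ->
  feasible \/ exists a b c,
    [/\ cuts (3 / 4) x a, cuts (3 / 4) y c & cuts 1 f b] /\
    [/\ (c 0 <= a 0)%N, (a 1 <= c 1)%N, (a 0 <= b 1)%N & (b 1 <= a 1)%N] /\
    1 / 4 <= F f (b 2) - F f (a 1) /\ 1 / 4 < F f (a 0) - F f (b 0).
Proof.
move=> tie ki0 cover; have [b0 sb0] := cut f.
case: tie => a0 [c0 [sa0 sc0 h0 h1]].
pose N := b0 0%N.
pose a := fun j => a0 (n * N + j)%N; pose c := fun j => c0 (n * N + j)%N.
have sa : cuts (3 / 4) x a by apply: cuts_shift.
have sc : cuts (3 / 4) y c by apply: cuts_shift.
have {h0}ca0 : (c 0 <= a 0)%N.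
  by rewrite /a /c ![(n * N + _)%N]addnC (cuts_period _ _ sa0) (cuts_period _ _ sc0) leq_add2r.
have {h1}ac1 : (a 1 <= c 1)%N.
  by rewrite /a /c ![(n * N + _)%N]addnC (cuts_period _ _ sa0) (cuts_period _ _ sc0) leq_add2r.
have [|i1 /andP[bi1 ib1]] := @cuts_locate f b0 (a 0%N) (cuts34 sb0).
  by rewrite /a addn0; apply: cuts_after sa0.
pose b := fun j => b0 (i1 + j)%N; have sb : cuts 1 f b by apply: cuts_shift.
have sb34 := cuts34 sb.
have {bi1}ba0 : (b 0 <= a 0)%N by rewrite /b addn0.
have {ib1}ab1 : (a 0 < b 1)%N by rewrite /b addn1.
clearbody a b c; clear a0 b0 c0 sa0 sb0 sc0 N i1.
have an : a n = (a 0 + m)%N by rewrite -(proj1 sa).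
have bn : b n = (b 0 + m)%N by rewrite -(proj1 sb).
have bn1 : b n.+1 = (b 1 + m)%N by rewrite -(proj1 sb) add1n.
have cn : c n = (c 0 + m)%N by rewrite -(proj1 sc).
have n1 : (1 + n.-1 = n)%N by natlia.
have n2 : (2 + n.-1 = n.+1)%N by natlia.
have a1n : (a 1 <= a n)%N by apply: cuts_leq sa _; natlia.
have b2n : (b 2 <= b n.+1)%N by apply: cuts_leq sb34 _; natlia.
have oka : ok G i0 (a 0) (a 1) by rewrite /ok /G ki0; apply: (proj2 sa).
(* After [a 1] both [x] and [y] still have n - 1 pieces; only the supply of [f] is in question. *)
have takeA : (forall i, kind i = f -> pieces G i (a 0 + m) (a 1) n.-1) -> feasible.
  move=> H; apply: (feasible_take oka); first by rewrite -an.
  move=> i; case: (cover i) => ki; last exact: H.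
    by apply: (cuts_pieces (j := 1) sa ki) => //; rewrite n1 an.
  by apply: (cuts_pieces (j := 1) sc ki) => //; rewrite n1 cn leq_add2r.
have [f0|/number_pos[i2 ki2]] := posnP (number f).
  left; apply: takeA => i ki; move: f0.
  by rewrite /number (count_take_out _ (in_agents i)) ki eqxx.
(* An interval inside the inner piece can go to an agent of [f] instead, again leaving n - 1 pieces
   to [x] and [y]. *)
have takeB s z : ok G i2 s z -> (z <= a 1)%N -> (a 0 <= s)%N -> (z <= s + m)%N ->
    (forall i, kind i = f -> pieces G i (s + m) z n.-1) -> feasible.
  move=> o za a0s zs H; apply: (feasible_take o) => // i.
  case: (cover i) => ki; last exact: H.
    by apply: (cuts_pieces (j := 1) sa ki) => //; rewrite n1 an leq_add2r.
  apply: (cuts_pieces (j := 1) sc ki); first exact: leq_trans ac1.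
  by rewrite n1 cn leq_add2r; apply: leq_trans a0s.
have [a1b1|b1a1] := leqP (a 1) (b 1).
  left; apply: takeA => i ki; apply: (cuts_pieces (j := 1) sb34 ki) => //.
  by rewrite n1 bn leq_add2r.
have [b2a1|a1b2] := leqP (b 2) (a 1).
  left; apply: (takeB (b 1%N) (b 2%N)) => //.
  - by rewrite /ok /G ki2; apply: (proj2 sb34).
  - exact: ltnW.
  - by rewrite -bn1.
  - by move=> i ki; apply: (cuts_pieces (j := 2) sb34 ki) => //; rewrite n2 bn1.
(* If less than 1/4 of the piece from [b 1] to [b 2] lies after [a 1], the part before it is worth
   3/4 to [f]; likewise at [a 0] below. *)
have [h|h] := lerP (1 / 4) (F f (b 2%N) - F f (a 1%N)); last first.
  left; apply: (takeB (b 1%N) (a 1%N)) => //.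
  - by rewrite /ok /G ki2; have := proj2 sb 1%N; lra.
  - exact: ltnW.
  - by rewrite -bn1; apply: leq_trans (ltnW a1b2) _.
  by move=> i ki; apply: (cuts_pieces (j := 2) sb34 ki); [apply: ltnW | rewrite n2 bn1].
have [h'|h'] := ltrP (1 / 4) (F f (a 0%N) - F f (b 0%N)); last first.
  left; apply: (takeB (a 0%N) (b 1%N)) => //.
  - by rewrite /ok /G ki2; have := proj2 sb 0%N; lra.
  - exact: ltnW.
  - by rewrite -an; apply: leq_trans (ltnW b1a1) _.
  by move=> i ki; apply: (cuts_pieces (j := 1) sb34 ki) => //; rewrite n1 bn leq_add2r.
right; exists a, b, c; split; first by [].
by split; last by []; split=> //; apply: ltnW.
Qed.

Let count_remove (P : pred 'I_n) i : count P agents = (P i + count P (rem i agents))%N.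
Proof. exact: count_take_out. Qed.

(** The knife starts at [a 1] with [s = 1]: the value 1/4 that [f] has before [b 2] makes up for the
    agent of [x] already served. *)
Lemma feasible_third x y f i0 : tied x y -> kind i0 = x -> x != f ->
    (forall i, [\/ kind i = x, kind i = y | kind i = f]) ->
    (2 * number f <= count (fun i => kind i != f) agents)%N ->
  feasible.
Proof.
move=> tie ki0 xf cover cnt.
have [//|[a [b [c [[sa sc sb] [[ca0 ac1 ab1 ba1] [hr hl]]]]]]] := tied_cases tie ki0 cover.
have an : a n = (a 0 + m)%N by rewrite -(proj1 sa).
have bn : b n = (b 0 + m)%N by rewrite -(proj1 sb).
have cn : c n = (c 0 + m)%N by rewrite -(proj1 sc).
have c1 := count_remove (fun i => kind i == f) i0.
have c2 := count_remove (fun i => kind i != f) i0.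
rewrite ki0 xf (negbTE xf) /= in c1 c2.
exists (a 0%N); apply: (serve_cons (in_agents i0) (z := a 1%N)).
  by rewrite /ok /G ki0; apply: (proj2 sa).
have Sn : n.-1.+1 = n by natlia.
apply: (@serve_flexible_third _ _ _ Gmono n.-1 _ (fun i => kind i == f) (F f)
   (fun j => b j.+1) (fun i j => if kind i == x then a j.+1 else c j.+1)
   _ _ _ _ _ _ 1%N _ 0%N).
- exact: Fmono.
- by move=> i z /eqP <-.
- by move=> j _; apply: (proj2 sb).
- by rewrite Sn bn Fper.
- move=> i j nf _; case: (cover i) nf => ki; rewrite /ok /G ki ?eqxx //= => _.
  + exact: (proj2 sa).
  + by case: (eqVneq y x) => [->|_]; [apply: (proj2 sa) | apply: (proj2 sc)].
- by move=> i _; case: ifP => _; rewrite Sn ?an ?cn ?leq_add2r.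
- by [].
- by rewrite size_rem // size_agents.
- by rewrite -an; apply: cuts_leq sa _; natlia.
- by move=> i _ _; case: ifP.
- by [].
- by move: cnt; rewrite /number c1 c2 addn1.
Qed.

(** Types in [J] are untied to [f], so their cuts stay 1/4 before the next cut of [f]; the knife
    runs from [a 1] with [s = 0]. *)
Lemma feasible_half x y f i0 (J : pred T) : tied x y -> kind i0 = x -> x != f -> y != f ->
    (forall i, [\/ kind i = x, kind i = y | kind i = f]) ->
    (forall k, J k -> (k == x) || (k == y)) ->
    (forall k, J k -> ~ tied k f) ->
    (number f <= count (fun i => J (kind i)) (rem i0 agents))%N ->
  feasible.
Proof.
move=> tie ki0 xf yf cover Jxy Jf cnt.
have [//|[a [b [c [[sa sc sb] [[ca0 ac1 ab1 ba1] [hr hl]]]]]]] := tied_cases tie ki0 cover.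
have an : a n = (a 0 + m)%N by rewrite -(proj1 sa).
have bn : b n = (b 0 + m)%N by rewrite -(proj1 sb).
have cn : c n = (c 0 + m)%N by rewrite -(proj1 sc).
have c1 := count_remove (fun i => kind i == f) i0.
rewrite ki0 (negbTE xf) /= add0n in c1.
exists (a 0%N); apply: (serve_cons (in_agents i0) (z := a 1%N)).
  by rewrite /ok /G ki0; apply: (proj2 sa).
have Sn : n.-1.+1 = n by natlia.
have deep k d : J k -> cuts (3 / 4) k d -> (d 0 <= b 1)%N -> (b 1 <= d 1)%N ->
    forall j, 1 / 4 <= F f (b j.+2) - F f (d j.+1).
  move=> Jk sd d0 d1 j; have fr := Jf k Jk; have fr' : ~ tied f k by move/tied_sym.
  apply/ltW/(free_deep_right fr sd sb).
  have := free_iter j fr sd (cuts34 sb) d1; rewrite !add1n => ->.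
  by have := free_iter j.+1 fr' (cuts34 sb) sd d0; rewrite add0n.
apply: (@serve_flexible_half _ _ _ Gmono n.-1 _ (fun i => kind i == f) (F f)
   (fun j => b j.+1) (fun i j => if kind i == x then a j.+1 else c j.+1)
   _ _ _ _ _ _ (fun i => J (kind i)) 0%N _ 0%N).
- exact: Fmono.
- by move=> i z /eqP <-.
- by move=> j _; apply: (proj2 sb).
- by rewrite Sn bn Fper.
- move=> i j nf _; case: (cover i) nf => ki; rewrite /ok /G ki ?eqxx //= => _.
  + exact: (proj2 sa).
  + by case: (eqVneq y x) => [->|_]; [apply: (proj2 sa) | apply: (proj2 sc)].
- by move=> i _; case: ifP => _; rewrite Sn ?an ?cn ?leq_add2r.
- by move=> i; rewrite !inE => /Jxy /orP[/eqP->|/eqP->].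
- move=> i j Ji _; case: ifP => [/eqP ki|ki].
    by apply: (deep x) => //; rewrite -ki.
  have ky : kind i = y by case/orP: (Jxy _ Ji) => /eqP //; move/eqP; rewrite ki.
  apply: (deep y) => //; first by rewrite -ky.
    exact: leq_trans ab1.
  exact: leq_trans ac1.
- by [].
- by rewrite size_rem // size_agents.
- by rewrite -an; apply: cuts_leq sa _; natlia.
- by move=> i _ _; case: ifP.
- by [].
- by move: cnt; rewrite /number c1 addn0.
Qed.

Lemma feasible_between x y f i0 a b c : x != f -> y != f -> kind i0 = f ->
    (forall i, [\/ kind i = x, kind i = y | kind i = f]) ->
    ~ tied x f -> ~ tied y f -> ~ tied x y ->
    cuts 1 x a -> cuts 1 f b -> cuts 1 y c ->
    (forall r, (a r <= b r <= c r)%N && (c r <= a r.+1)%N) ->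
    (number f <= count (fun i => kind i != f) agents)%N ->
    (number y <= count (fun i => kind i != y) agents)%N ->
  feasible.
Proof.
move=> xf yf ki0 cover frx fry frxy sa1 sb sc1 abc cntf cnty.
have sa := cuts34 sa1; have sc := cuts34 sc1.
have ab r : (a r <= b r)%N by case/andP: (abc r) => /andP[].
have bc r : (b r <= c r)%N by case/andP: (abc r) => /andP[].
have ca r : (c r <= a r.+1)%N by case/andP: (abc r).
have ba r : (b r <= a r.+1)%N := leq_trans (bc r) (ca r).
have cb r : (c r <= b r.+1)%N := leq_trans (ca r) (ab _).
have al r : 1 / 4 < F f (a r.+1) - F f (b r).
  by apply: (free_deep_left frx sa sb); rewrite ba ab.
have ar r : 1 / 4 < F f (b r.+1) - F f (a r.+1).
  by apply: (free_deep_right frx sa sb); rewrite ba ab.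
have cl r : 1 / 4 < F f (c r) - F f (b r).
  by apply: (free_deep_left fry sc sb); rewrite bc cb.
have cr r : 1 / 4 < F f (b r.+1) - F f (c r).
  by apply: (free_deep_right fry sc sb); rewrite bc cb.
(* An interval from [a r] to [c r] worth 3/4 to [f] goes to an agent of [f]: up to [a r + m] both
   [x] and [y] keep n - 1 pieces, and all rigid agents play [J]. *)
have [[r hr]|none] := classic (exists r, 3 / 4 <= F f (c r) - F f (a r)).
  have arn : a (r + n)%N = (a r + m)%N := proj1 sa r.
  have c1 := count_remove (fun i => kind i == f) i0.
  have c2 := count_remove (fun i => kind i != f) i0.
  rewrite ki0 eqxx /= in c1 c2.
  have rn : ((r + n.-1).+1 = r + n)%N by natlia.
  exists (a r); apply: (serve_cons (in_agents i0) (z := c r)).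
    by rewrite /ok /G ki0.
  apply: (@serve_flexible_half _ _ _ Gmono n.-1 _ (fun i => kind i == f) (F f)
    (fun j => b (r + j)%N) (fun i j => if kind i == x then a (r + j).+1 else c (r + j)%N)
    _ _ _ _ _ _ (fun i => kind i != f) 0%N _ 0%N).
  - exact: Fmono.
  - by move=> i z /eqP <-.
  - by move=> j _; rewrite addnS; apply: (proj2 sb).
  - by rewrite -arn -rn.
  - move=> i j nf _; case: (cover i) nf => ki; rewrite /ok /G ki ?eqxx //= => _.
    + by rewrite addnS; apply: (proj2 sa).
    + case: (eqVneq y x) => [->|_]; rewrite addnS; last exact: (proj2 sc).
      exact: (proj2 sa).
  - move=> i _; rewrite -arn -rn; case: ifP => _ //; exact: ca.
  - by [].
  - move=> i j _ _; rewrite addnS; case: ifP => _; apply: ltW; [exact: ar | exact: cr].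
  - by [].
  - by rewrite size_rem // size_agents.
  - by rewrite -arn; apply: leq_trans (ca r) (cuts_leq sa _); natlia.
  - by move=> i _ _; rewrite addn0; case: ifP => _ //; exact: ca.
  - by rewrite addnS addn0; apply: ltW; exact: cr.
  - by move: cntf; rewrite /number c1 c2 addn0; apply: leq_trans; rewrite add1n.
have small r : F f (c r) - F f (a r) < 3 / 4.
  by rewrite ltNge; apply/negP => h; apply: none; exists r.
have easyE i : (kind i == x) || (kind i == f) = (kind i != y).
  have yx : (y == x) = false.
    apply/negP => /eqP yx; apply: frxy; rewrite yx.
    by exists a, a; rewrite !leqnn.
  have [->|k] := eqVneq (kind i) y; first by rewrite yx (negbTE yf).
  by case: (cover i) k => ->; rewrite ?eqxx ?orbT.
apply: (feasible_halves (easy := fun k => (k == x) || (k == f)) (cuts_shift 1 sa)).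
- move=> k j /orP[] /eqP -> ; first exact: (proj2 (cuts_shift 1 sa)).
  (* To [f], the way from [a j.+1] to [c j.+2] is worth more than 1/4 + 1 + 1/4, and the part of it
     after [a j.+2] less than 3/4. *)
  rewrite !add1n; have := ar j; have := cl j.+2; have := small j.+2.
  by have := proj2 sb j.+1; lra.
- by move=> i; rewrite easyE negbK => /eqP ->.
- rewrite (eq_count (a2 := fun i => kind i == y)); last by move=> i; rewrite /= easyE negbK.
  by rewrite (eq_count (a1 := fun i => _ || _) (a2 := fun i => kind i != y)).
Qed.

(** * Case analysis on ties and on the sizes of the types *)

Definition kinds x y f := [/\ x != y, x != f, y != f &
  forall i, [\/ kind i = x, kind i = y | kind i = f]].

Lemma kinds_swap x y f : kinds x y f -> kinds y x f.
Proof.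
case=> xy xf yf cover; split=> //; first by rewrite eq_sym.
by move=> i; case: (cover i); [constructor 2 | constructor 1 | constructor 3].
Qed.

Lemma kinds_rot x y f : kinds x y f -> kinds y f x.
Proof.
case=> xy xf yf cover; split=> //; try by rewrite eq_sym.
by move=> i; case: (cover i); [constructor 3 | constructor 1 | constructor 2].
Qed.

Lemma count_two_kinds x y f : kinds x y f ->
  count (fun i => kind i != f) agents = (number x + number y)%N.
Proof.
case=> xy xf yf cover; rewrite /number; elim: agents => //= i l ->.
have yx : (y == x) = false by rewrite eq_sym (negbTE xy).
have fx : (f == x) = false by rewrite eq_sym (negbTE xf).
have fy : (f == y) = false by rewrite eq_sym (negbTE yf).
by case: (cover i) => ->; rewrite ?eqxx ?xf ?yf ?(negbTE xy) ?yx ?fx ?fy //=; natlia.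
Qed.

(** The splitting of [f] itself is used: each piece suits the majority, and the others find 3/4 in
    one of any two consecutive pieces. *)
Lemma feasible_dominant x y f : kinds x y f ->
  ((0 < number x)%N -> ~ tied x f) -> ((0 < number y)%N -> ~ tied y f) ->
  (number x + number y <= number f)%N -> feasible.
Proof.
move=> kxyf frx fry le; have [b sb] := cut f.
have pos i : (0 < number (kind i))%N.
  by rewrite /number -has_count; apply/hasP; exists i; rewrite /= ?eqxx.
apply: (feasible_halves (easy := fun k => k == f) (cuts34 sb)).
- by move=> k j /eqP ->; apply: (proj2 (cuts34 sb)).
- case: kxyf => _ _ _ cover i /= kf; case: (cover i) (pos i) => ki; rewrite ki => p.
  + by move/tied_sym; apply: frx.
  + by move/tied_sym; apply: fry.
  + by rewrite ki eqxx in kf.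
- by rewrite /= (count_two_kinds kxyf).
Qed.

(** As [f] is the smallest type, the count for [feasible_third] holds; if [x] is absent, so is [f],
    and everybody has type [y]. *)
Lemma feasible_all_tied x y f : kinds x y f -> tied x y ->
  (number f <= number x)%N -> (number f <= number y)%N -> feasible.
Proof.
move=> kxyf tie nx ny; have [x0|/number_pos[i0 ki0]] := posnP (number x).
  apply: (feasible_dominant (kinds_rot (kinds_rot kxyf))); rewrite ?x0 //.
    by move: nx; rewrite x0 leqn0 => /eqP ->.
  by rewrite addn0 ny.
case: (kxyf) => xy xf yf cover; apply: (feasible_third tie ki0 xf cover).
by rewrite (count_two_kinds kxyf); natlia.
Qed.

(** The inner piece goes to [x], so all agents of [y] remain to play [J]. *)
Lemma feasible_one_free x y f : kinds x y f -> ~ tied y f -> tied x y ->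
  (number f <= number y)%N -> feasible.
Proof.
move=> kxyf fr tie le; have [x0|/number_pos[i0 ki0]] := posnP (number x).
  apply: (feasible_dominant (kinds_rot (kinds_rot kxyf))); rewrite ?x0 ?addn0 //.
  by move=> _ /tied_sym.
case: (kxyf) => xy xf yf cover.
apply: (feasible_half (J := fun k => k == y) tie ki0 xf yf cover).
- by move=> k ->; rewrite orbT.
- by move=> k /eqP ->.
have := count_remove (fun i => kind i == y) i0.
by rewrite ki0 (negbTE xy) add0n => <-.
Qed.

(** Either [f] dominates, or [x] and [y], even after one agent has left, together are at least as
    many as [f] and play [J]. *)
Lemma feasible_two_free x y f : kinds x y f -> ~ tied x f -> ~ tied y f -> tied x y -> feasible.
Proof.
wlog x0 : x y / (0 < number x)%N.
  move=> H kxyf frx fry tie; have [x0|] := posnP (number x); last by move=> h; apply: (H x y).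
  have [y0|] := posnP (number y); last first.
    by move=> h; apply: (H y x) => //; [apply: kinds_swap | apply: tied_sym].
  by apply: (feasible_dominant kxyf) => //; rewrite x0 y0.
move=> kxyf frx fry tie; have [le|lt] := leqP (number x + number y) (number f).
  exact: (feasible_dominant kxyf).
have [i0 ki0] := number_pos x0; case: (kxyf) => xy xf yf cover.
apply: (feasible_half (J := fun k => (k == x) || (k == y)) tie ki0 xf yf cover) => //.
  by move=> k /orP[] /eqP ->.
have c1 := count_remove (fun i => (kind i == x) || (kind i == y)) i0.
rewrite ki0 eqxx in c1.
have c2 : count (fun i => (kind i == x) || (kind i == y)) agents = (number x + number y)%N.
  rewrite -(count_two_kinds kxyf); apply: eq_count => i.
  by case: (cover i) => ->; rewrite ?eqxx ?xf ?yf ?orbT // ![f == _]eq_sym (negbTE xf) (negbTE yf).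
by move: lt; rewrite -c2 c1 add1n ltnS.
Qed.

Lemma feasible_all_free x y f : kinds x y f -> ~ tied x y -> ~ tied x f -> ~ tied y f -> feasible.
Proof.
move=> kxyf frxy frxf fryf.
have fryx : ~ tied y x by move/tied_sym.
have frfx : ~ tied f x by move/tied_sym.
have frfy : ~ tied f y by move/tied_sym.
have kyfx := kinds_rot kxyf; have kfxy := kinds_rot kyfx.
have nf := count_two_kinds kxyf; have nx := count_two_kinds kyfx; have ny := count_two_kinds kfxy.
have [lf|lf] := leqP (number x + number y) (number f); first exact: (feasible_dominant kxyf).
have [lx|lx] := leqP (number y + number f) (number x); first exact: (feasible_dominant kyfx).
have [ly|ly] := leqP (number f + number x) (number y); first exact: (feasible_dominant kfxy).
have [a0 sa0] := cut x; have [b0 sb0] := cut y; have [c0 sc0] := cut f.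
have sa := cuts_shift (n * (b0 0 + c0 0)) sa0; set a := fun j => _ in sa.
have a_far : (b0 0 + c0 0 <= a 0)%N by rewrite /a addn0; apply: cuts_after (cuts34 sa0).
have [||b sb ab] := free_align (b := b0) frxy (cuts34 sa).
- exact: sb0.
- exact: leq_trans (leq_addr _ _) a_far.
have [||c sc ac] := free_align (b := c0) frxf (cuts34 sa).
- exact: sc0.
- exact: leq_trans (leq_addl _ _) a_far.
(* Shifted by one, the cuts [b r] and [c r] follow [a r]; whichever of the two comes first belongs
   to the middle type. *)
have {}sb := cuts_shift 1 sb; have {}sc := cuts_shift 1 sc.
have between (d : nat -> nat) : (forall r, (d r <= a r <= d r.+1)%N) ->
    forall r, (a r <= d (1 + r))%N && (d (1 + r) <= a r.+1)%N.
  by move=> h r; have /andP[_ ->] := h r; have /andP[-> _] := h r.+1.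
have {}ab := between b ab; have {}ac := between c ac.
have [bc|cb] := leqP (b (1 + 0)%N) (c (1 + 0)%N).
  have [i0 ki0] : exists i, kind i = y by apply: number_pos; natlia.
  have kxfy := kinds_swap kfxy.
  case: (kxfy) => xf xy fy cover.
  apply: (feasible_between xy fy ki0 cover frxy frfy frxf sa sb sc).
  - move=> r; have /andP[-> _] := ab r; have /andP[_ ->] := ac r; rewrite andbT /=.
    exact: (free_iter (i := 0%N) (k := 0%N) r frfy (cuts34 sc) (cuts34 sb)).
  - by rewrite ny; natlia.
  - by rewrite nf; natlia.
have [i0 ki0] : exists i, kind i = f by apply: number_pos; natlia.
case: (kxyf) => xy xf yf cover.
apply: (feasible_between xf yf ki0 cover frxf fryf frxy sa sc sb).
- move=> r; have /andP[-> _] := ac r; have /andP[_ ->] := ab r; rewrite andbT /=.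
  exact: (free_iter (i := 0%N) (k := 0%N) r fryf (cuts34 sb) (cuts34 sc) (ltnW cb)).
- by rewrite nf; natlia.
- by rewrite ny; natlia.
Qed.

(** The role of [f] falls to the smallest type if all pairs are tied, to the smaller type of a
    single untied pair, and to the type untied to both others if exactly one pair is tied. *)
Lemma feasible_three_kinds x y z : kinds x y z -> feasible.
Proof.
move=> kxyz; have kyzx := kinds_rot kxyz; have kzxy := kinds_rot kyzx.
have [txy|fxy] := classic (tied x y); have [txz|fxz] := classic (tied x z);
  have [tyz|fyz] := classic (tied y z).
- have [xy|yx] := leqP (number x) (number y).
    have [xz|zx] := leqP (number x) (number z); first exact: (feasible_all_tied kyzx).
    by apply: (feasible_all_tied kxyz) => //; natlia.
  have [yz|zy] := leqP (number y) (number z).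
    by apply: (feasible_all_tied kzxy) => //; [apply: tied_sym | natlia].
  by apply: (feasible_all_tied kxyz) => //; natlia.
- have [yz|/ltnW zy] := leqP (number y) (number z).
    by apply: (feasible_one_free (kinds_swap kzxy)) => // /tied_sym.
  exact: (feasible_one_free kxyz).
- have [xz|/ltnW zx] := leqP (number x) (number z).
    by apply: (feasible_one_free kyzx) => // /tied_sym.
  by apply: (feasible_one_free (kinds_swap kxyz)) => //; apply: tied_sym.
- exact: (feasible_two_free kxyz).
- have [xy|/ltnW yx] := leqP (number x) (number y).
    by apply: (feasible_one_free (kinds_swap kyzx)) => //; [move/tied_sym | apply: tied_sym].
  by apply: (feasible_one_free kzxy) => //; apply: tied_sym.
- by apply: (feasible_two_free kzxy) => //; [move/tied_sym | apply: tied_sym].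
- by apply: (feasible_two_free kyzx) => // /tied_sym.
- exact: (feasible_all_free kxyz).
Qed.

End Cycle.

(** * The intervals of the served agents *)

Section Owners.
Variables (R : realFieldType) (I : eqType) (G : I -> nat -> R).
Hypothesis Gmono : forall i x y, (x <= y)%N -> G i x <= G i y.

Lemma serve_le t s l : serve G t s l -> (s <= t)%N.
Proof. by elim=> // {}s z i {}l _ /(ok_lt Gmono) /ltnW sz _; apply: leq_trans. Qed.

Lemma serve_owner t s l : serve G t s l -> uniq l -> l != [::] ->
  exists own : nat -> I, (forall z, (s <= z < t)%N -> own z \in l) /\
    forall i, i \in l -> exists x y, [/\ (s <= x)%N, (x <= y <= t)%N, ok G i x y &
      forall z, (s <= z < t)%N -> (own z == i) = (x <= z < y)%N].
Proof.
elim=> // {}s z i {}l il o sv IH ul _.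
have zt := serve_le sv; have sz := ltnW (ok_lt Gmono o).
have lr j : (j \in l) = (j == i) || (j \in rem i l) by rewrite (perm_mem (perm_to_rem il)) inE.
have [l0|/(IH (rem_uniq i ul))[own [ownl ownP]]] := eqVneq (rem i l) [::].
  exists (fun=> i); split=> // j; rewrite lr l0 in_nil orbF => /eqP ->.
  exists s, t; split=> //; first by rewrite (leq_trans sz zt) leqnn.
    exact: (ok_widen Gmono (leqnn _) zt o).
  by move=> w ->; rewrite eqxx.
have ir : i \notin rem i l by rewrite mem_rem_uniq // inE eqxx.
exists (fun w => if (w < z)%N then i else own w); split=> [w /andP[sw wt]|j].
  by case: ltnP => // zw; rewrite lr ownl ?orbT // zw.
rewrite lr => /predU1P[->|jr].
  exists s, z; rewrite leqnn sz zt; split=> // w /andP[sw wt]; rewrite sw /=.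
  case: ltnP => [|zw]; first by rewrite eqxx.
  by apply/negbTE; apply: contraNneq ir => e; rewrite -{1}e; apply: ownl; rewrite zw.
have [x [y [zx xyt oxy H]]] := ownP j jr; exists x, y; split=> //.
  exact: leq_trans zx.
move=> w /andP[sw wt]; case: ltnP => [wz|zw]; last by apply: H; rewrite zw.
have ij : i != j by apply: contraNneq ir => ij; rewrite {1}ij.
by rewrite (negbTE ij) leqNgt (leq_trans wz zx).
Qed.
End Owners.

(** * Arcs of the cycle and splits *)

Section Arcs.
Variables (R : realFieldType) (m n : nat).
Hypothesis m_gt0 : (0 < m)%N.

Definition good (z : nat) : 'I_m := Ordinal (ltn_pmod z m_gt0).

Lemma good_id (g : 'I_m) : good g = g.
Proof. by apply: val_inj; rewrite /= modn_small. Qed.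

Lemma goodD z q : good (z + q * m) = good z.
Proof. by apply: val_inj; rewrite /= addnC modnMDl. Qed.

Lemma good_inj x y z : (x <= y)%N -> (x <= z)%N -> (y < x + m)%N -> (z < x + m)%N ->
  good y = good z -> y = z.
Proof.
move=> xy xz ym zm /(congr1 val) /= /eqP; rewrite -(subnKC xy) -(subnKC xz) eqn_modDl.
by rewrite !modn_small ?ltn_subLR // => /eqP ->.
Qed.

(** The representative of [g] in the turn that starts at [s]. *)
Definition lift s (g : 'I_m) := ((if s %% m <= g then s %/ m else (s %/ m).+1) * m + g)%N.

Lemma good_lift s g : good (lift s g) = g.
Proof. by rewrite /lift addnC goodD good_id. Qed.

Lemma lift_bounds s g : (s <= lift s g < s + m)%N.
Proof.
have gm := ltn_ord g; have rm := ltn_pmod s m_gt0; have sE := divn_eq s m.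
rewrite /lift; have [rg|rg] := leqP (s %% m)%N g; rewrite ?mulSn.
  by apply/andP; split; natlia.
by apply/andP; split; natlia.
Qed.

Lemma lift_good s z : (s <= z < s + m)%N -> lift s (good z) = z.
Proof.
case/andP=> sz zs; have /andP[h1 h2] := lift_bounds s (good z).
exact: (good_inj h1 sz h2 zs (good_lift s (good z))).
Qed.

Lemma arc_is_bundle (S : {set 'I_m}) x y :
    (forall z, (x <= z < y)%N -> good z \in S) ->
    (forall g, g \in S -> exists2 z, (x <= z < y)%N & g = good z) ->
  is_bundle S.
Proof.
move=> inS ofS; pose e := fun a b : 'I_m => [&& a \in S, b \in S & cyc_adj a b].
have esym : connect_sym e.
  by apply: sym_connect_sym => a b; rewrite /e /cyc_adj andbCA orbC.
have up z d : (x <= z)%N -> (z + d < y)%N -> connect e (good z) (good (z + d)).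
  move=> xz; elim: d => [|d IH] zd; first by rewrite addn0 connect0.
  apply: connect_trans (IH _) (connect1 _); first by natlia.
  rewrite /e !inS; try (apply/andP; split; natlia).
  by rewrite /cyc_adj /= addnS -addn1 modnDml addn1 eqxx.
apply/forall_inP => g /ofS[z /andP[xz zy] ->]; apply/forall_inP => h /ofS[w /andP[xw wy] ->].
have [zw|/ltnW wz] := leqP z w; first by rewrite -(subnKC zw) up // subnKC.
by rewrite esym -(subnKC wz) up // subnKC.
Qed.

Lemma uval_arc (u : 'I_m -> R) (S : {set 'I_m}) x y : (x <= y <= x + m)%N ->
    (forall z, (x <= z < y)%N -> good z \in S) ->
    (forall g, g \in S -> exists2 z, (x <= z < y)%N & g = good z) ->
  uval u S = \sum_(x <= w < y) u (good w).
Proof.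
case/andP=> xy yx inS ofS; rewrite -(big_map good predT u) big_uniq; last first.
  rewrite map_inj_in_uniq ?iota_uniq // => a b; rewrite !mem_index_iota.
  move=> /andP[xa ay] /andP[xb by_].
  by apply: (good_inj xa xb); apply: leq_trans yx.
apply: eq_bigl => g; apply/idP/mapP => [/ofS[z zb ->]|[z zb ->]].
  by exists z; rewrite ?mem_index_iota.
by apply: inS; rewrite mem_index_iota in zb.
Qed.

Lemma owner_split s (own : nat -> 'I_n) (x y : 'I_n -> nat) :
    (forall i, (s <= x i <= y i)%N && (y i <= s + m)%N) ->
    (forall i z, (s <= z < s + m)%N -> (own z == i) = (x i <= z < y i)%N) ->
  exists2 P : {ffun 'I_m -> 'I_n}, is_split P & forall (u : 'I_m -> R) i,
    uval u (bundle_of P i) = \sum_(x i <= w < y i) u (good w).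
Proof.
move=> b H; exists [ffun g => own (lift s g)].
  apply/forallP => i; have /andP[/andP[sx xy] ys] := b i.
  apply: (@arc_is_bundle _ (x i) (y i)) => [z zb|g].
    rewrite inE ffunE lift_good ?H //; first by case/andP: zb => h1 h2; apply/andP; split; natlia.
    by case/andP: zb => h1 h2; apply/andP; split; natlia.
  rewrite inE ffunE H ?lift_bounds // => h; exists (lift s g) => //.
  by rewrite good_lift.
move=> u i; have /andP[/andP[sx xy] ys] := b i.
apply: uval_arc => [|z zb|g].
- by rewrite xy; natlia.
- rewrite inE ffunE lift_good ?H //; first by case/andP: zb => h1 h2; apply/andP; split; natlia.
  by case/andP: zb => h1 h2; apply/andP; split; natlia.
rewrite inE ffunE H ?lift_bounds // => h; exists (lift s g) => //.
by rewrite good_lift.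
Qed.

Lemma uval_le_arc (u : 'I_m -> R) (S : {set 'I_m}) x y : (forall g, 0 <= u g) ->
    (forall g, g \in S -> exists2 z, (x <= z < y)%N & g = good z) ->
  uval u S <= \sum_(x <= w < y) u (good w).
Proof.
move=> u0 ofS; rewrite /uval.
have -> : \sum_(x <= w < y) u (good w) = \sum_g \sum_(x <= w < y | good w == g) u g.
  rewrite (exchange_big_dep predT) //=; apply: eq_bigr => w _.
  by rewrite (big_pred1 (good w)) // => g; rewrite /= eq_sym.
rewrite big_mkcond; apply: ler_sum => g _; case: ifP => [/ofS[z zb ->]|_]; last first.
  by apply: sumr_ge0.
rewrite big_mkcond (bigD1_seq z) ?iota_uniq ?mem_index_iota //= eqxx lerDl.
by apply: sumr_ge0 => w _; case: ifP.
Qed.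

(** Positivity rules out the default value 0 of the maximum. *)
Lemma mms_attained (u : 'I_m -> R) : 0 < mms n u ->
  exists2 P : {ffun 'I_m -> 'I_n}, is_split P & forall i, mms n u <= uval u (bundle_of P i).
Proof.
rewrite /mms; set M := \big[_/_]_(_ | _) _ => M0.
suff [|[P sP h]] : M <= 0 \/ exists2 P : {ffun 'I_m -> 'I_n}, is_split P & M <= split_min u P.
- by rewrite leNgt M0.
- by exists P => // i; apply: le_trans h _; apply: bigmin_le.
rewrite /M; elim/big_rec: _ => [|P v sP IH]; first by left.
by rewrite /Num.max; case: ifP => // _; right; exists P.
Qed.

(** * Cutting a split into consecutive arcs *)

Section Starts.
Variables (P : {ffun 'I_m -> 'I_n}).
Hypothesis (splitP : is_split P) (n_gt1 : (1 < n)%N).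
Hypothesis nonempty : forall i, exists g, P g = i.

(** Walking on from a good of another bundle, the first good of bundle [i] is its start. The offset
    [m.-1] leads to the predecessor on the cycle. *)
Lemma bundle_start i : exists s,
  (s < m)%N && ((P (good s) == i) && (P (good (s + m.-1)) != i)).
Proof.
have [g gi] := nonempty i.
have [j ji] : exists j : 'I_n, j != i.
  have [i0|i0] := eqVneq (val i) 0%N; last by exists (Ordinal (ltnW n_gt1)); rewrite -val_eqE /= eq_sym.
  by exists (Ordinal n_gt1); rewrite -val_eqE /= i0.
have [h hj] := nonempty j.
have ex : exists k, P (good (h + k)) == i.
  exists (g + (m - h))%N; have -> : (h + (g + (m - h)) = g + 1 * m)%N.
    by have := ltn_ord h; natlia.
  by rewrite goodD good_id gi.
case: (ex_minnP ex) => -[|k] Pk kmin.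
  by move: Pk; rewrite addn0 good_id hj (negbTE ji).
exists ((h + k.+1) %% m)%N; rewrite ltn_pmod //=.
have mE q : good (q %% m) = good q by apply: val_inj; rewrite /= modn_mod.
have -> : good ((h + k.+1) %% m + m.-1) = good (h + k).
  apply: val_inj; rewrite /= modnDml.
  have -> : (h + k.+1 + m.-1 = h + k + m)%N by natlia.
  by rewrite modnDr.
by rewrite mE Pk; apply/negP => /kmin; rewrite ltnn.
Qed.

(** Along a path inside the bundle, every good reached lies in the unbroken run from [s]: a step
    back from [s] leaves the bundle, and a step forward after a whole turn returns to [s]. *)
Lemma bundle_run i s : P (good (s + m.-1)) != i -> P (good s) = i ->
  forall g, P g = i -> exists2 k, good (s + k) = g & forall k', (k' <= k)%N -> P (good (s + k')) = i.
Proof.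
move=> before Ps g Pg.
pose e := fun a b : 'I_m => [&& a \in bundle_of P i, b \in bundle_of P i & cyc_adj a b].
have : connect e (good s) g.
  have /forall_inP/(_ (good s)) := forallP splitP i.
  by rewrite inE Ps eqxx => /(_ isT)/forall_inP/(_ g); rewrite inE Pg eqxx => /(_ isT).
pose Q a := exists2 k, (k < m)%N && (good (s + k) == a) &
  forall k', (k' <= k)%N -> P (good (s + k')) = i.
have step a b : e a b -> Q a -> Q b.
  rewrite /e !inE => /and3P[_ /eqP Pb adj] [k /andP[km /eqP ka] run].
  case/orP: adj => /eqP ab.
    have {}ab : good (s + k.+1) = b.
      by apply: val_inj; rewrite /= -ab -ka /= addnS -addn1 -[in RHS]addn1 modnDml.
    have [k1|k1] := ltnP k.+1 m.
      exists k.+1; first by rewrite k1 ab eqxx.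
      by move=> k'; rewrite leq_eqVlt => /predU1P[->|/run//]; rewrite ab.
    exists 0%N; last by move=> k'; rewrite leqn0 => /eqP ->; rewrite addn0.
    have kE : k.+1 = m by apply/eqP; rewrite eqn_leq k1 km.
    by rewrite m_gt0 addn0 -ab kE -{2}[m]mul1n goodD /=.
  have bE : b = good (s + k + m.-1).
    apply: val_inj; rewrite /= -modnDml; have /(congr1 val) /= -> := ka.
    rewrite -ab modnDml; have -> : (b.+1 + m.-1 = b + m)%N by natlia.
    by rewrite modnDr modn_small.
  case: k km ka run bE => [|k] km ka run bE.
    by move: before; rewrite -[s]addn0 -bE Pb eqxx.
  exists k; last by move=> k' kk; apply: run; apply: leqW.
  rewrite (ltnW km) bE; have -> : (s + k.+1 + m.-1 = s + k + 1 * m)%N by natlia.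
  by rewrite goodD eqxx.
have Qs : Q (good s).
  by exists 0%N; rewrite ?m_gt0 ?addn0 ?eqxx // => k'; rewrite leqn0 => /eqP ->; rewrite addn0.
case/connectP => p pp ->.
have [k /andP[_ /eqP kg] run] : Q (last (good s) p).
  elim: p (good s) pp Qs => //= a p IH b /andP[ba pa] Qb.
  by apply: (IH _ pa); apply: step ba Qb.
by exists k.
Qed.

(** The cuts are the sorted starts of the bundles, closed by the first start one turn later. A
    bundle fits before the next cut, since its run cannot pass the start of another bundle. *)
Lemma split_cut (u : 'I_m -> R) (c : R) : (forall g, 0 <= u g) ->
    (forall i, c <= uval u (bundle_of P i)) ->
  exists p : nat -> nat, (p n <= p 0 + m)%N /\
    forall j, (j < n)%N -> c <= \sum_(p j <= w < p j.+1) u (good w).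
Proof.
move=> u0 cu; have [s sP] := fin_all_exists bundle_start.
have sm i : (s i < m)%N by case/andP: (sP i).
have Ps i : P (good (s i)) = i by case/andP: (sP i) => _ /andP[/eqP].
have before i : P (good (s i + m.-1)) != i by case/andP: (sP i) => _ /andP[].
have s_inj : injective s by move=> a b e; rewrite -(Ps a) e Ps.
pose r := sort leq (map s (enum 'I_n)).
have sr : size r = n by rewrite size_sort size_map size_enum_ord.
have ur : uniq r by rewrite sort_uniq map_inj_uniq ?enum_uniq.
have sort_r : sorted leq r by apply: sort_sorted; apply: leq_total.
have rP j : (j < n)%N -> exists i, nth 0%N r j = s i.
  move=> jn; have : nth 0%N r j \in r by rewrite mem_nth ?sr.
  by rewrite mem_sort => /mapP[i _ ->]; exists i.
exists (fun j => if (j < n)%N then nth 0%N r j else nth 0%N r 0 + m)%N.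
have n0 : (0 < n)%N by natlia.
rewrite ltnn n0; split=> // j jn; rewrite jn.
have [i iE] := rP j jn; rewrite iE.
apply: le_trans (cu i) _; apply: uval_le_arc => // g.
rewrite inE => /eqP Pg; have [k kg run] := bundle_run (before i) (Ps i) Pg.
exists (s i + k)%N; last by [].
rewrite leq_addr /=; case: (ltnP j.+1 n) => j1.
  have [i' iE'] := rP _ j1; rewrite iE' ltnNge; apply/negP => h.
  have ss : (s i <= s i')%N.
    by rewrite -iE -iE'; apply: (sorted_leq_nth leq_trans leqnn) => //; rewrite inE sr.
  have : P (good (s i + (s i' - s i))) = i by apply: run; natlia.
  rewrite subnKC // Ps => ii; move/eqP: iE'; rewrite ii -iE nth_uniq ?sr //.
  by rewrite (gtn_eqF (ltnSn j)).
have [i' iE'] := rP _ n0; rewrite iE' ltnNge; apply/negP => h.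
have : P (good (s i + (s i' + m - s i))) = i by apply: run; have := sm i; natlia.
rewrite subnKC; last by have := sm i; natlia.
have -> : good (s i' + m) = good (s i') by have := goodD (s i') 1; rewrite mul1n.
rewrite Ps => ii; move/eqP: iE'; rewrite ii -iE nth_uniq ?sr //.
by move/eqP => j0; move: j1; rewrite -j0 leqNgt n_gt1.
Qed.

End Starts.
End Arcs.

Lemma sum_good_period (R : realFieldType) (m : nat) (m_gt0 : (0 < m)%N) (u : 'I_m -> R) x y :
  (x <= y)%N ->
  \sum_(x + m <= w < y + m) u (good m_gt0 w) = \sum_(x <= w < y) u (good m_gt0 w).
Proof.
move=> xy; rewrite big_addn addnK; apply: eq_bigr => w _.
by have := goodD m_gt0 w 1; rewrite mul1n => ->.
Qed.

(** * Scaling the utilities and assembling the allocation *)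

Theorem theorem4p9 (R : realFieldType) (m n : nat) (U : 'I_n -> 'I_m -> R)
  (hn : (0 < n)%N)
  (hU : forall i g, 0 <= U i g)
  (htypes : exists t : 'I_3 -> 'I_m -> R, forall i, exists k, U i = t k) :
  exists P : {ffun 'I_m -> 'I_n}, c_sufficient (3 / 4) U P.
Proof.
have uval0 i S : 0 <= uval (U i) S by apply: sumr_ge0.
have low i S : mms n (U i) <= 0 -> 3 / 4 * mms n (U i) <= uval (U i) S.
  by move=> h; apply: le_trans (uval0 i S); lra.
have [m0|m_gt0] := posnP m.
  have no_good (g : 'I_m) : False.
    by have := ltn_ord g; move: (nat_of_ord g) => q; rewrite m0.
  exists [ffun=> Ordinal hn]; split.
    by apply/forallP => i; apply/forall_inP => g; case: (no_good g).
  move=> i; apply: low; rewrite leNgt; apply/negP => h; have [P _ /(_ i)] := mms_attained h.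
  by rewrite /uval big1 => [|g _]; [rewrite leNgt h | case: (no_good g)].
have [[i0 pos0]|none] := classic (exists i, 0 < mms n (U i)); last first.
  have [||P sP _] := @owner_split R m n m_gt0 0 (fun=> Ordinal hn) (fun=> 0%N)
      (fun i => if i == Ordinal hn then m else 0%N).
  - by move=> i; case: ifP; rewrite !leq0n ?add0n ?leqnn.
  - by move=> i z /andP[_ zm]; rewrite eq_sym; case: eqP => _; rewrite // (leq_trans zm).
  exists P; split=> // i; apply: low; rewrite leNgt; apply/negP => h.
  by apply: none; exists i.
have [n1|n_neq1] := eqVneq n 1%N.
  have [P sP hP] := mms_attained pos0; exists P; split=> // i.
  have val0 (j : 'I_n) : val j = 0%N.
    by have := ltn_ord j; rewrite /=; move: (nat_of_ord j) => q; rewrite n1; case: q.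
  have -> : i = i0 by apply: val_inj; rewrite !val0.
  by apply: le_trans (hP i0); lra.
have n_gt1 : (1 < n)%N by rewrite ltn_neqAle eq_sym n_neq1.
case: htypes => t /fin_all_exists[kind kindE].
(* A type without an agent of positive share is replaced by [U i0], so that every share is positive
   and can be scaled to 1. *)
pose v k := if [exists i, (kind i == k) && (0 < mms n (U i))] then t k else U i0.
have vE k : exists2 i, v k = U i & 0 < mms n (U i).
  rewrite /v; case: ifP => [/existsP[i /andP[/eqP <- h]]|_]; last by exists i0.
  by exists i.
have v0 k g : 0 <= v k g by have [i -> _] := vE k.
have vpos k : 0 < mms n (v k) by have [i -> h] := vE k.
pose S k x := \sum_(0 <= w < x) v k (good m_gt0 w).
have SB k x y : (x <= y)%N -> S k y - S k x = \sum_(x <= w < y) v k (good m_gt0 w).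
  by move=> xy; rewrite /S (big_cat_nat (n := x)) //= addrAC subrr add0r.
pose F k x := S k x / mms n (v k).
have FB k x y : F k y - F k x = (S k y - S k x) / mms n (v k) by rewrite /F mulrBl.
have Fmono k x y : (x <= y)%N -> F k x <= F k y.
  move=> xy; rewrite -subr_ge0 FB SB //; apply: divr_ge0; last exact: ltW.
  by apply: sumr_ge0 => w _; apply: v0.
have Fper k x y : F k (y + m) - F k (x + m) = F k y - F k x.
  wlog xy : x y / (x <= y)%N.
    by move=> H; have [/H//|/ltnW/H e] := leqP x y; rewrite -opprB e opprB.
  by rewrite !FB !SB ?leq_add2r // sum_good_period.
have cut k : exists b, cuts m n F 1 k b.
  have [P sP hP] := mms_attained (vpos k).
  (* A bundle worth at least the positive share cannot be empty. *)
  have ne i : exists g, P g = i.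
    apply: NNPP => no; have := vpos k; rewrite ltNge; move/negP; apply.
    apply: le_trans (hP i) _; rewrite /uval big1 // => g; rewrite inE => /eqP gi.
    by case: no; exists g.
  have [p [pn hp]] := split_cut m_gt0 sP n_gt1 ne (v0 k) hP.
  have [|b sb _] := cuts_periodize n_gt1 Fmono Fper (c := 1) (k := k) _ pn; last by exists b.
  move=> j jn; rewrite FB ler_pdivlMr ?vpos // mul1r.
  have := hp j jn; have [le|lt] := leqP (p j) (p j.+1); first by rewrite SB.
  by rewrite big_geq ?(ltnW lt) // leNgt vpos.
have [s sv] : feasible m F kind.
  apply: (feasible_three_kinds n_gt1 Fmono Fper cut (x := 0) (y := 1) (z := 2)).
  by split=> // i; case: (kind i) => -[|[|[|//]]] h; [constructor 1|constructor 2|constructor 3]; apply: val_inj.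
have [|||own [_ ownP]] := @serve_owner R _ (fun i => F (kind i)) _ _ _ _ sv.
- by move=> i x y; apply: Fmono.
- exact: enum_uniq.
- by rewrite -size_eq0 size_enum_ord; natlia.
have /fin_all_exists[x /fin_all_exists[y xyP]] i := ownP i (mem_enum _ i).
have [||P sP hP] := @owner_split R m n m_gt0 s own x y.
- by move=> i; have [-> /andP[-> ->]] := xyP i.
- by move=> i; have [_ _ _] := xyP i.
exists P; split=> // i; rewrite hP.
(* An agent without positive share may have been served for a substitute utility, but any bundle
   satisfies it. *)
have [nonpos|pos] := lerP (mms n (U i)) 0.
  by rewrite -hP; apply: low.
have vi : v (kind i) = U i.
  by rewrite /v kindE; case: existsP => // -[]; exists i; rewrite eqxx -?kindE.
have [_ /andP[xy _] o _] := xyP i.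
by move: o; rewrite /ok FB SB // vi ler_pdivlMr.
Qed.
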